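(* Let $N\ge 1$, let $\mathbf{X}=\{X_1,\dots,X_N\}$ be a set of $N$ distinct nodes, and for each $i\in\{1,\dots,N\}$ let $\mathcal{S}_i=\{\mathbf{S}_{i,1},\dots,\mathbf{S}_{i,Q_i}\}$ be a finite collection of $Q_i=|\mathcal{S}_i|$ candidate parent-sets with $\mathbf{S}_{i,j}\subseteq \mathbf{X}\setminus\{X_i\}$ for all $j\in\{1,\dots,Q_i\}$. Let $\Delta>0$ be an arbitrary real number. Let $\boldsymbol{\eta}=(\boldsymbol{\eta}_1^T,\dots,\boldsymbol{\eta}_N^T)^T$ be a real vector with blocks $\boldsymbol{\eta}_i=(\eta_{i,1},\dots,\eta_{i,Q_i})^T$, and for $i\ne j$ put $$a_{i,j}=\sum_{k=1}^{Q_j}\eta_{j,k}\,\mathbb{1}(X_i\in\mathbf{S}_{j,k}).$$ Then $\boldsymbol{\eta}$ represents a directed acyclic graph (DAG) if and only if there exist real numbers $o_1,\dots,o_N$ with $0\le o_i\le\Delta$ for all $i\in\{1,\dots,N\}$ such that all of the following constraints hold: $$\eta_{i,j}\ge 0\qquad\text{for all } i\in\{1,\dots,N\},\ j\in\{1,\dots,Q_i\},$$ $$\sum_{j=1}^{Q_i}\eta_{i,j}=1\qquad\text{for all } i\in\{1,\dots,N\},$$ $$\eta_{i,j}\in\mathbb{Z}\qquad\text{for all } i\in\{1,\dots,N\},\ j\in\{1,\dots,Q_i\},$$ $$(1-a_{i,j})\,2\Delta+o_j-o_i\ \ge\ \frac{\Delta}{N}\qquad\text{for all } i,j\in\{1,\dots,N\},\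 i\ne j.$$
   Context: $\mathbb{1}(\cdot)$ denotes the indicator function (1 if the condition is true, 0 otherwise). A vector $\boldsymbol{\eta}=(\boldsymbol{\eta}_1^T,\dots,\boldsymbol{\eta}_N^T)^T$ is said to represent a directed graph if each block $\boldsymbol{\eta}_i$ contains exactly one entry equal to 1 and all its other entries equal 0; the position $k$ of the entry 1 in $\boldsymbol{\eta}_i$ indicates that $\mathbf{S}_{i,k}$ is the selected parent-set of node $X_i$. The represented directed graph has node set $\{X_1,\dots,X_N\}$ and an edge $X_i\to X_j$ exactly when $X_i$ belongs to the selected parent-set of $X_j$. The vector $\boldsymbol{\eta}$ represents a DAG if it represents a directed graph in this sense and that directed graph has no directed cycle. *)

(* Defs.v *)
From mathcomp Require Import all_boot all_order all_algebra.
From mathcomp Require Import reals.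
Set Implicit Arguments.
Unset Strict Implicit.
Unset Printing Implicit Defensive.
Import Order.TTheory GRing.Theory Num.Theory.
Local Open Scope ring_scope.

(* Node X_(i+1) is the ordinal [i : 'I_N]; [S i k] is the [k]-th candidate
   parent-set of node [i], and [eta i] is the [i]-th block of the vector. *)

Definition one_hot (R : realType) (n : nat) (v : 'cV[R]_n) : Prop :=
  exists k : 'I_n, v k 0 = 1 /\ forall l : 'I_n, l != k -> v l 0 = 0.

Definition represents_digraph (R : realType) (N : nat) (Q : 'I_N -> nat)
    (eta : forall i : 'I_N, 'cV[R]_(Q i)) : Prop :=
  forall i : 'I_N, one_hot (eta i).

(* The selected parent-set of [j] is the [S j k] with [eta j k 0 = 1]; this is
   meaningful only when [represents_digraph eta] holds. *)
Definition edge (R : realType) (N : nat) (Q : 'I_N -> nat)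
    (S : forall i : 'I_N, 'I_(Q i) -> {set 'I_N})
    (eta : forall i : 'I_N, 'cV[R]_(Q i)) : rel 'I_N :=
  fun i j => [exists k : 'I_(Q j), (eta j k 0 == 1) && (i \in S j k)].

(* [cycle e [::]] holds vacuously, hence the exclusion of the empty sequence. *)
Definition acyclic (T : eqType) (e : rel T) : Prop :=
  forall p : seq T, p != [::] -> ~~ cycle e p.

Definition represents_dag (R : realType) (N : nat) (Q : 'I_N -> nat)
    (S : forall i : 'I_N, 'I_(Q i) -> {set 'I_N})
    (eta : forall i : 'I_N, 'cV[R]_(Q i)) : Prop :=
  represents_digraph eta /\ acyclic (edge S eta).

Definition adj (R : realType) (N : nat) (Q : 'I_N -> nat)
    (S : forall i : 'I_N, 'I_(Q i) -> {set 'I_N})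
    (eta : forall i : 'I_N, 'cV[R]_(Q i)) (i j : 'I_N) : R :=
  \sum_(k < Q j) eta j k 0 * (i \in S j k)%:R.

(* Main.v *)
(* Along an edge the order constraint reads [o j - o i >= Delta / N], so [o]
   strictly increases along paths and there is no directed cycle; without an
   edge the slack [2 * Delta] makes it vacuous. Conversely, for a DAG take
   [o i] to be [Delta / N] times the number of nodes from which [i] is
   reachable. *)
Require Import Defs.
From mathcomp Require Import all_boot all_order all_algebra.
From mathcomp Require Import reals lra.
Set Implicit Arguments.
Unset Strict Implicit.
Unset Printing Implicit Defensive.
Import Order.TTheory GRing.Theory Num.Theory.
Local Open Scope ring_scope.

(** Nonnegative integers are naturals, and naturals with sum 1 have a single nonzero term, equal to
    1. This trades [represents_digraph] for the three constraints on [eta] alone. *)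
Lemma one_hotP (R : realType) (n : nat) (v : 'cV[R]_n) :
  one_hot v <->
  [/\ forall k, 0 <= v k 0, \sum_k v k 0 = 1
    & forall k, v k 0 \is a Num.int].
Proof.
split=> [[k [vk v0]]|[v_ge0 v_sum v_int]].
  split=> [l||l].
  - by have [->|/v0->] := eqVneq l k; rewrite ?vk ?ler01.
  - by rewrite (bigD1 k) //= vk big1 ?addr0.
  - by have [->|/v0->] := eqVneq l k; rewrite ?vk ?rpred0 ?rpred1.
have v_nat k : true -> v k 0 \is a Num.nat by rewrite natrEint v_int v_ge0.
have [k [_ vk v0]] := natr_sum_eq1 v_nat v_sum.
by exists k; split=> // l /v0->.
Qed.

(** Only the selected parent-set of [j] survives in the sum, so the order constraint has just two
    cases: edge or no edge. *)
Lemma adj_edge (R : realType) (N : nat) (Q : 'I_N -> nat)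
    (S : forall i : 'I_N, 'I_(Q i) -> {set 'I_N})
    (eta : forall i : 'I_N, 'cV[R]_(Q i)) (i j : 'I_N) :
  one_hot (eta j) -> adj S eta i j = (edge S eta i j)%:R.
Proof.
case=> k [etak eta0].
have -> : edge S eta i j = (i \in S j k).
  apply/existsP/idP=> [[l /andP[/eqP etal]]|iSk]; last first.
    by exists k; rewrite etak eqxx.
  have [->//|/eta0 etal0] := eqVneq l k.
  by move/eqP: etal; rewrite etal0 eq_sym oner_eq0.
rewrite /adj (bigD1 k) //= etak mul1r big1 ?addr0 // => l /eta0->.
by rewrite mul0r.
Qed.

Lemma edge_irrefl (R : realType) (N : nat) (Q : 'I_N -> nat)
    (S : forall i : 'I_N, 'I_(Q i) -> {set 'I_N})
    (eta : forall i : 'I_N, 'cV[R]_(Q i)) :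
  (forall (i : 'I_N) (k : 'I_(Q i)), S i k \subset [set~ i]) ->
  irreflexive (edge S eta).
Proof.
move=> S_sub i; apply/existsP=> -[k /andP[_ /(subsetP (S_sub i k))]].
by rewrite !inE eqxx.
Qed.

(** A cycle through [x] is a path from [x] back to [x]; by transitivity it would give
    [o x < o x]. *)
Lemma increasing_acyclic (R : realType) (T : eqType) (e : rel T) (o : T -> R) :
  (forall x y, e x y -> o x < o y) -> acyclic e.
Proof.
move=> o_inc [//|x p] _; apply/negP => /= /(sub_path o_inc).
move=> /(order_path_min (fun y x z => @lt_trans _ _ (o y) (o x) (o z))).
by rewrite all_rcons ltxx.
Qed.

(** The edge extends every path ending in [x] to [y]. The inclusion is strict because [y] reaches
    itself by the empty path, whereas a path from [y] to [x] would close up into a cycle. *)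
Lemma acyclic_ancestors (T : finType) (e : rel T) (x y : T) :
  acyclic e -> e x y ->
  (#|[set z | connect e z x]| < #|[set z | connect e z y]|)%N.
Proof.
move=> acyc exy; apply/proper_card/properP; split.
  apply/subsetP=> z; rewrite !inE => /connect_trans; apply.
  exact: connect1.
exists y; rewrite !inE ?connect0 //; apply/negP => /connectP[p p_path x_last].
have /negP[] := acyc (y :: p) isT.
by rewrite /= rcons_path p_path -x_last.
Qed.

Theorem proposition1 (R : realType) (N : nat) (N_ge1 : (1 <= N)%N)
    (Q : 'I_N -> nat) (S : forall i : 'I_N, 'I_(Q i) -> {set 'I_N})
    (S_inj : forall i : 'I_N, injective (S i))
    (S_sub : forall (i : 'I_N) (k : 'I_(Q i)), S i k \subset [set~ i])
    (Delta : R) (Delta_gt0 : 0 < Delta)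
    (eta : forall i : 'I_N, 'cV[R]_(Q i)) :
  represents_dag S eta <->
  exists o : 'I_N -> R,
    (forall i : 'I_N, 0 <= o i <= Delta) /\
    [/\ forall (i : 'I_N) (k : 'I_(Q i)), 0 <= eta i k 0,
        forall i : 'I_N, \sum_(k < Q i) eta i k 0 = 1,
        forall (i : 'I_N) (k : 'I_(Q i)), eta i k 0 \is a Num.int
      & forall i j : 'I_N, i != j ->
          (1 - adj S eta i j) * (2 * Delta) + o j - o i >= Delta / N%:R].
Proof.
have N_gt0 : 0 < N%:R :> R by rewrite ltr0n.
have step_gt0 : 0 < Delta / N%:R by rewrite divr_gt0.
have step_le : Delta / N%:R <= Delta.
  by rewrite ler_pdivrMr // ler_peMr ?ler1n // ltW.
split=> [[hot acyc]|[o [o_bnd [eta_ge0 eta_sum eta_int ord]]]].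
  pose o i := Delta / N%:R * #|[set z | connect (edge S eta) z i]|%:R.
  have o_bnd i : 0 <= o i <= Delta.
    rewrite /o mulr_ge0 ?ler0n ?(ltW step_gt0) //= -mulrA.
    rewrite ler_piMr ?(ltW Delta_gt0) //.
    by rewrite mulrC ler_pdivrMr // mul1r ler_nat -[leqRHS]card_ord max_card.
  exists o; split=> //; split=> [i||i|i j ij].
  - by have [] := (one_hotP (eta i)).1 (hot i).
  - by move=> i; have [] := (one_hotP (eta i)).1 (hot i).
  - by have [] := (one_hotP (eta i)).1 (hot i).
  rewrite adj_edge //; case: (boolP (edge S eta i j)) => [eij|_].
    (* The counts are integers, so strict growth along the edge means a gap of at least 1, that is,
       one full step [Delta / N]. *)
    rewrite subrr mul0r add0r /o -mulrBr ler_peMr ?(ltW step_gt0) //.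
    by rewrite lerBrDl natr1 ler_nat acyclic_ancestors.
  (* Since [o j - o i >= - Delta], the left side is at least [Delta], which [step_le] compares with
     [Delta / N]. *)
  have /andP[_ oi_le] := o_bnd i; have /andP[oj_ge0 _] := o_bnd j.
  by rewrite subr0 mul1r; lra.
have hot : represents_digraph eta by move=> i; apply/one_hotP; split.
split=> //; apply: (@increasing_acyclic R _ _ o) => i j eij.
(* The order constraint is silent on loops; these are excluded by [S_sub]. *)
have ij : i != j by apply: contraTneq eij => ->; rewrite edge_irrefl.
have := ord i j ij; rewrite adj_edge // eij subrr mul0r add0r.
by move=> /(lt_le_trans step_gt0); rewrite subr_gt0.
Qed.
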